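(* Consider the triangular model $Y=Y_0+\Delta D$, $D=\mathbf 1\{\Theta-\Gamma_1(Z_1+g(Z_2,\dots,Z_L))-\sum_{l=2}^L\Gamma_l f_l(Z_l)>0\}$, $L\ge2$, with $Z\perp(\Theta,\Gamma)\mid X$ and $\Gamma_1>0$ a.s. Assume (A1), (A2), (A3); either (A4) or (A4'); and either (Full support) or (Analytic), as defined in the context. Then for $x\in\mathrm{supp}(\mathbb P_X)$ and $(y_0,y_1,\delta)\in\mathbb R^3$, $$F^L_{Y_0,Y_1|X}(y_0,y_1|x)\le F_{Y_0,Y_1|X}(y_0,y_1|x)\le F^U_{Y_0,Y_1|X}(y_0,y_1|x),$$ $$F^L_{\Delta|X}(\delta|x)\le F_{\Delta|X}(\delta|x)\le F^U_{\Delta|X}(\delta|x),$$ where, for $B\in\{L,U\}$ (a label for lower or upper), $$F^B_{Y_0,Y_1|X}(y_0,y_1|x)=\int_{\mathbb R^{L}}F^B_{Y_0,Y_1|C}(y_0,y_1|\theta,\gamma_{2-L},x)\,d\mathbb P_{\overline\Theta,\overline\Gamma_{2-L}|X}(\theta,\gamma_{2-L}|x),$$ $$F^B_{\Delta|X}(\delta|x)=\int_{\mathbb R^{L}}F^B_{\Delta|C}(\delta|\theta,\gamma_{2-L},x)\,d\mathbb P_{\overline\Theta,\overline\Gamma_{2-L}|X}(\theta,\gamma_{2-L}|x),$$ and the integrands are the conditional bounds given $C=(\overline\Theta,\overline\Gamma_{2-L},X)$ defined in the context.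
   Context: $Y_0,\Delta$ are real random variables, $Y_1:=Y_0+\Delta$; $D\in\{0,1\}$; $Z=(Z_1,\dots,Z_L)$ is a vector of instruments; $X$ is a vector of conditioning variables; $\Theta$ is real and $\Gamma=(\Gamma_1,\dots,\Gamma_L)$ is a real random vector. For a vector $A$, $A_{2-L}=(A_2,\dots,A_L)$. $\mathbb P_{A|B}(\cdot|b)$ and $F_{A|B}(\cdot|b)$ are the conditional law and CDF of $A$ given $B=b$, taken from consistent regular conditional distributions. $\mathrm{supp}$ is the support, $\mathrm{Int}$ the interior. Put $\overline\Theta=\Theta/\Gamma_1$, $\overline\Gamma_l=\Gamma_l/\Gamma_1$, $\overline Z_l=f_l(Z_l)$ for $l=2,\dots,L$. The superscripts $L$, $U$ on $F$ mean lower and upper bound; in $\mathbb R^{L}$, $L$ is the number of instruments. Conditional bounds, with $C=(\overline\Theta,\overline\Gamma_{2-L},X)$ and $c=(\theta,\gamma_{2-L},x)$: $F^L_{Y_0,Y_1|C}(y_0,y_1|c)=\max\{F_{Y_0|C}(y_0|c)+F_{Y_1|C}(y_1|c)-1,0\}$; $F^U_{Y_0,Y_1|C}(y_0,y_1|c)=\min\{F_{Y_0|C}(y_0|c),F_{Y_1|C}(y_1|c)\}$; $F^L_{\Delta|C}(\delta|c)=\sup_{y\in\mathbb R}\max\{F_{Y_1|C}(y|c)-F_{Y_0|C}(y-\delta|c),0\}$; $F^U_{\Delta|C}(\delta|c)=1+\inf_{y\in\mathbb R}\min\{F_{Y_1|C}(y|c)-F_{Y_0|C}(y-\delta|c),0\}$.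 Treatment of $g,f_2,\dots,f_L$: under (A4) these functions may be unknown, but the normalizations $\mathbb E[|g(Z_{2-L})|+\sum_{l=2}^L(|\overline\Gamma_l|+|f_l(Z_l)|)]<\infty$, and for each $l=2,\dots,L$, $\mathbb E[g(Z_{2-L})|Z_l,X]=0$, $\mathbb E[\overline\Gamma_l|X]=1$, $\mathbb E[f_l(Z_l)|X]=0$ a.s., are maintained, and the functions are treated as known; under (A4') they are known. Assumptions. (A1) $\mathbb E[|Y_0|+|\Delta|]<\infty$. (A2) $Z\perp(Y_d,\overline\Theta,\overline\Gamma_{2-L})\mid X$ for $d=0,1$. (A3) $0<\mathbb P(D=1\mid X)<1$ a.s. (A4) for all $(z_{2-L},x)\in\mathrm{supp}(\mathbb P_{Z_{2-L},X})$, $\mathrm{supp}(\mathbb P_{Z_1|Z_{2-L},X}(\cdot|z_{2-L},x))\supseteq\mathrm{supp}(\mathbb P_{\overline\Theta-g(z_{2-L})-\sum_{l=2}^L\overline\Gamma_l f_l(z_l)|X}(\cdot|x))$. (A4') (a) the selection equation contains no unknown functions; (b) for all $x\in\mathrm{supp}(\mathbb P_X)$ and $R\ge0$, $\mathbb E[\exp(R|\overline\Theta|)\mid X=x]<\infty$; (c) for all $(z_{2-L},x)\in\mathrm{supp}(\mathbb P_{\overline Z_{2-L},X})$, $\mathrm{Int}(\mathrm{supp}(\mathbb P_{Z_1|\overline Z_{2-L},X}(\cdot|z_{2-L},x)))\neq\emptyset$. (Full support) for all $x\in\mathrm{supp}(\mathbb P_X)$, $\mathrm{supp}(\mathbb P_{\overline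 Z_{2-L}|X}(\cdot|x))=\mathbb R^{L-1}$. (Analytic) for all $x\in\mathrm{supp}(\mathbb P_X)$: for all $R\ge0$, $\mathbb E[\exp(R\|\overline\Gamma_{2-L}\|)\mid X=x]<\infty$; and $\mathrm{Int}(\mathrm{supp}(\mathbb P_{\overline Z_{2-L}|X}(\cdot|x)))\neq\emptyset$. *)

(* Defs.v *)
From HB Require Import structures.
From mathcomp Require Import all_boot all_order all_algebra.
From mathcomp Require Import all_classical all_reals all_analysis.

Set Implicit Arguments.
Unset Strict Implicit.
Unset Printing Implicit Defensive.

Import Order.TTheory GRing.Theory Num.Theory.
Import numFieldNormedType.Exports.

Local Open Scope classical_set_scope.
Local Open Scope ring_scope.

(** Row vectors with the sigma-algebra generated by the coordinates, i.e. the
    Borel sigma-algebra.  The library puts no sigma-algebra on ['rV[R]_m]. *)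
Definition rvec (R : realType) (m : nat) :=
  g_sigma_algebraType [set A : set 'rV[R]_m |
    exists (i : 'I_m) (B : set R), measurable B /\ A = [set v | B (v 0 i)]].

Definition enorm (R : realType) (m : nat) (v : rvec R m) : R :=
  Num.sqrt (\sum_(i < m) (v 0 i) ^+ 2).

(** For L = n.+2, components are indexed from 0: [hd v] is v_1, and the l-th
    component of [tl v] = (v_2, ..., v_L) is v_{l+2}. *)
Definition hd (R : realType) (n : nat) (v : rvec R n.+2) : R := v 0 ord0.
Definition tl (R : realType) (n : nat) (v : rvec R n.+2) : rvec R n.+1 :=
  \row_(l < n.+1) v 0 (lift ord0 l).

Definition supp (R : realType) (T : topologicalType) (mu : set T -> \bar R) :
    set T :=
  [set x | forall U : set T, open U -> U x -> (0 < mu U)%E].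

(** [k] is a regular conditional distribution of A given B: for each measurable
    U, [k (B w) U] is a version of P(A \in U | B). *)
Definition is_rcd (R : realType) d (Omega : measurableType d)
    (P : probability Omega R) dA (TA : measurableType dA)
    dB (TB : measurableType dB) (A : Omega -> TA) (B : Omega -> TB)
    (k : R.-pker TB ~> TA) : Prop :=
  forall (U : set TA) (V : set TB), measurable U -> measurable V ->
    (\int[P]_(w in B @^-1` V) k (B w) U = P (A @^-1` U `&` B @^-1` V))%E.

(** A regular conditional distribution [kX] of A given X and another one [kB] of
    A given (b(A), X) are consistent when the law of total probability
    P_{A|X}(U|x) = \int P_{A|b(A),X}(U|t,x) dP_{b(A)|X}(t|x)
    holds at every x in the support of X, and not merely almost surely. *)
Definition consistent (R : realType) d (Omega : measurableType d)
    (P : probability Omega R) k (X : Omega -> rvec R k)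
    dA (TA : measurableType dA) dT (T : measurableType dT)
    (kX : R.-pker (rvec R k) ~> TA) (b : TA -> T)
    (kB : R.-pker (T * rvec R k)%type ~> TA) : Prop :=
  forall x : rvec R k, supp (pushforward P X) x ->
  forall U : set TA, measurable U ->
    (kX x U = \int[pushforward (kX x) b]_t kB (t, x) U)%E.

(** a(A) and b(A) are independent given X, where [kX] is a regular conditional
    distribution of A given X. *)
Definition cond_indep (R : realType) d (Omega : measurableType d)
    (P : probability Omega R) k (X : Omega -> rvec R k)
    dA (TA : measurableType dA) (kX : R.-pker (rvec R k) ~> TA)
    d1 (T1 : measurableType d1) d2 (T2 : measurableType d2)
    (a : TA -> T1) (b : TA -> T2) : Prop :=
  forall (U : set T1) (V : set T2), measurable U -> measurable V ->
    {ae P, forall w, (kX (X w) (a @^-1` U `&` b @^-1` V) =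
                      kX (X w) (a @^-1` U) * kX (X w) (b @^-1` V))%E}.

(** h(B) is a version of E[H | B]. *)
Definition is_cond_exp (R : realType) d (Omega : measurableType d)
    (P : probability Omega R) dB (TB : measurableType dB) (B : Omega -> TB)
    (H : Omega -> R) (h : TB -> R) : Prop :=
  [/\ measurable_fun setT h,
      P.-integrable setT (EFin \o H),
      P.-integrable setT (EFin \o (h \o B)) &
      forall V : set TB, measurable V ->
        (\int[P]_(w in B @^-1` V) (H w)%:E =
         \int[P]_(w in B @^-1` V) (h (B w))%:E)%E].

(** Values of the vector (Y_0, Delta, D, Z, Theta, Gamma).  All conditional laws
    are images of conditional laws of this whole vector. *)
Definition vars (R : realType) (n : nat) : Type :=
  (R * R * bool * rvec R n.+2 * R * rvec R n.+2)%type.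

Section variables.
Context {R : realType} {n : nat}.
Implicit Types v : vars R n.

Definition vY0 v : R := let: (y0, _, _, _, _, _) := v in y0.
Definition vDelta v : R := let: (_, dl, _, _, _, _) := v in dl.
Definition vD v : bool := let: (_, _, b, _, _, _) := v in b.
Definition vZ v : rvec R n.+2 := let: (_, _, _, z, _, _) := v in z.
Definition vTheta v : R := let: (_, _, _, _, t, _) := v in t.
Definition vGamma v : rvec R n.+2 := let: (_, _, _, _, _, c) := v in c.

Definition vY1 v : R := vY0 v + vDelta v.

Definition vThetabar v : R := vTheta v / hd (vGamma v).
Definition vGammabar v : rvec R n.+1 :=
  \row_(l < n.+1) (tl (vGamma v) 0 l / hd (vGamma v)).
Definition vZtl v : rvec R n.+1 := tl (vZ v).
Definition vZbar (f : 'I_n.+1 -> R -> R) v : rvec R n.+1 :=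
  \row_(l < n.+1) f l (tl (vZ v) 0 l).
Definition vCoef v : R * rvec R n.+1 := (vThetabar v, vGammabar v).

End variables.

Section assumptions.
Context (R : realType) (n k : nat) d (Omega : measurableType d).
Context (P : probability Omega R).
Context (W : Omega -> vars R n) (X : Omega -> rvec R k).
Context (g : rvec R n.+1 -> R) (f : 'I_n.+1 -> R -> R).
Context (kX : R.-pker (rvec R k) ~> vars R n).
Context (kZ : R.-pker (rvec R n.+1 * rvec R k)%type ~> vars R n).

Definition assumption_A1 : Prop :=
  (\int[P]_w (`|vY0 (W w)| + `|vDelta (W w)|)%:E < +oo)%E.

Definition assumption_A2 : Prop :=
  cond_indep P X kX vZ (fun v => (vY0 v, vThetabar v, vGammabar v)) /\
  cond_indep P X kX vZ (fun v => (vY1 v, vThetabar v, vGammabar v)).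

Definition assumption_A3 : Prop :=
  {ae P, forall w, (0 < kX (X w) [set v | vD v = true] < 1)%E}.

Definition normalizations : Prop :=
  (\int[P]_w (`|g (vZtl (W w))| + \sum_(l < n.+1)
      (`|vGammabar (W w) 0 l| + `|f l (vZtl (W w) 0 l)|))%:E < +oo)%E /\
  forall l : 'I_n.+1,
    [/\ is_cond_exp P (fun w => (vZtl (W w) 0 l, X w))
          (fun w => g (vZtl (W w))) (fun=> 0),
        is_cond_exp P X (fun w => vGammabar (W w) 0 l) (fun=> 1) &
        is_cond_exp P X (fun w => f l (vZtl (W w) 0 l)) (fun=> 0)].

(** Here [kZ] is the conditional distribution given (Z_{2-L}, X). *)
Definition assumption_A4 : Prop :=
  forall (z : rvec R n.+1) (x : rvec R k),
    supp (pushforward P (fun w => (vZtl (W w), X w))) (z, x) ->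
    supp (pushforward (kX x) (fun v =>
        vThetabar v - g z - \sum_(l < n.+1) vGammabar v 0 l * f l (z 0 l)))
    `<=` supp (pushforward (kZ (z, x)) (fun v => hd (vZ v))).

(** Here [kZ] is the conditional distribution given (bar Z_{2-L}, X).  That the
    selection equation contains no unknown function is a condition on the
    analyst's information, not on the law of the variables: [g] and [f] are
    fixed parameters, and [assumption_A4'] puts no normalization on them. *)
Definition assumption_A4' : Prop :=
  (forall x : rvec R k, supp (pushforward P X) x -> forall r : R, 0 <= r ->
    (\int[kX x]_v (expR (r * `|vThetabar v|))%:E < +oo)%E) /\
  (forall (z : rvec R n.+1) (x : rvec R k),
    supp (pushforward P (fun w => (vZbar f (W w), X w))) (z, x) ->
    (supp (pushforward (kZ (z, x)) (fun v => hd (vZ v))))° !=set0).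

Definition full_support : Prop :=
  forall x : rvec R k, supp (pushforward P X) x ->
    supp (pushforward (kX x) (vZbar f)) = [set: 'rV[R]_n.+1].

Definition analytic : Prop :=
  forall x : rvec R k, supp (pushforward P X) x ->
    (forall r : R, 0 <= r ->
      (\int[kX x]_v (expR (r * enorm (vGammabar v)))%:E < +oo)%E) /\
    (supp (pushforward (kX x) (vZbar f)))° !=set0.

End assumptions.

Section bounds.
Context {R : realType}.
Local Open Scope ereal_scope.

Definition cdf_of d (T : measurableType d) (mu : set T -> \bar R) (h : T -> R)
  (y : R) : \bar R := mu [set v | (h v <= y)%R].

Definition joint_cdf_of d (T : measurableType d) (mu : set T -> \bar R)
    (h0 h1 : T -> R) (y0 y1 : R) : \bar R :=
  mu [set v | (h0 v <= y0)%R /\ (h1 v <= y1)%R].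

Definition joint_lower (F0 F1 : R -> \bar R) (y0 y1 : R) : \bar R := maxe (F0 y0 + F1 y1 - 1) 0.
Definition joint_upper (F0 F1 : R -> \bar R) (y0 y1 : R) : \bar R := mine (F0 y0) (F1 y1).
Definition diff_lower (F0 F1 : R -> \bar R) (dl : R) : \bar R :=
  ereal_sup (range (fun y : R => maxe (F1 y - F0 (y - dl)%R) 0)).
Definition diff_upper (F0 F1 : R -> \bar R) (dl : R) : \bar R :=
  1 + ereal_inf (range (fun y : R => mine (F1 y - F0 (y - dl)%R) 0)).

End bounds.

(** The bounds on F_{Y_0,Y_1|X}(.|x) and F_{Delta|X}(.|x): integrals over
    (theta, gamma_{2-L}) of the bounds given C = (bar Theta, bar Gamma_{2-L}, X),
    [kC] being the conditional distribution given C. *)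
Section integrated_bounds.
Context {R : realType} {n k : nat}.
Context (kX : R.-pker (rvec R k) ~> vars R n).
Context (kC : R.-pker (R * rvec R n.+1 * rvec R k)%type ~> vars R n).
Implicit Type c : R * rvec R n.+1.
Local Open Scope ereal_scope.

Definition FL_Y0Y1 (y0 y1 : R) (x : rvec R k) : \bar R :=
  \int[pushforward (kX x) vCoef]_c
    joint_lower (cdf_of (kC (c, x)) vY0) (cdf_of (kC (c, x)) vY1) y0 y1.

Definition FU_Y0Y1 (y0 y1 : R) (x : rvec R k) : \bar R :=
  \int[pushforward (kX x) vCoef]_c
    joint_upper (cdf_of (kC (c, x)) vY0) (cdf_of (kC (c, x)) vY1) y0 y1.

Definition FL_Delta (dl : R) (x : rvec R k) : \bar R :=
  \int[pushforward (kX x) vCoef]_c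
    diff_lower (cdf_of (kC (c, x)) vY0) (cdf_of (kC (c, x)) vY1) dl.

Definition FU_Delta (dl : R) (x : rvec R k) : \bar R :=
  \int[pushforward (kX x) vCoef]_c
    diff_upper (cdf_of (kC (c, x)) vY0) (cdf_of (kC (c, x)) vY1) dl.

End integrated_bounds.

(* Main.v *)
(** Conditionally on C = c the events {Y0 <= y0} and {Y1 <= y1} satisfy the
    Frechet-Hoeffding inequalities, and {Delta <= dl} satisfies the Makarov
    inequalities, since for every y
      {Y1 <= y} is contained in {Y0 <= y - dl} or {Delta <= dl}, and
      {Delta <= dl} is contained in {Y1 <= y} or {Y0 > y - dl}.
    Consistency of the conditional distributions writes the laws given X = x as
    mixtures of the laws given C, so the bounds survive integration over c. *)

Require Import Defs.
From HB Require Import structures.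
From mathcomp Require Import all_boot all_order all_algebra.
From mathcomp Require Import all_classical all_reals all_analysis.
From mathcomp Require Import measurable_realfun lra.

Set Implicit Arguments.
Unset Strict Implicit.
Unset Printing Implicit Defensive.

Import Order.TTheory GRing.Theory Num.Theory.
Import numFieldNormedType.Exports.

Local Open Scope classical_set_scope.
Local Open Scope ring_scope.

Section subadditivity.
Context {R : realType} {d : measure_display} {T : measurableType d}.
Variable mu : {measure set T -> \bar R}.
Local Open Scope ereal_scope.

Lemma le_measureU2 (A B C : set T) :
  measurable A -> measurable B -> measurable C -> A `<=` B `|` C ->
  mu A <= mu B + mu C.
Proof.
move=> mA mB mC ABC; apply: le_trans (measureU2 _ mB mC).
by apply: le_measure => //; rewrite inE //; exact: measurableU.
Qed.

Hypothesis mu1 : mu setT = 1.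

Lemma fin_num_measure1 (A : set T) : measurable A -> mu A \is a fin_num.
Proof.
move=> mA; rewrite ge0_fin_numE//.
apply: (@le_lt_trans _ _ (mu setT)); last by rewrite mu1 ltry.
by apply: le_measure => //; rewrite inE.
Qed.

(** The complement of [C] has mass [1 - mu C], so this is again subadditivity. The right-hand side
    is grouped to match the terms of [diff_upper]. *)
Lemma le_measure1UC (A B C : set T) :
  measurable A -> measurable B -> measurable C -> A `<=` B `|` ~` C ->
  mu A <= 1 + (mu B - mu C).
Proof.
move=> mA mB mC ABC.
have mC' := measurableC mC.
have fC := fin_num_measure1 mC.
(* Once the total mass is split this way, [mu C] cancels because it is finite. *)
have <- : mu C + mu (~` C) = 1.
  by rewrite -measureU// ?setUv// setICr.
rewrite addeC addeA subeK//.
exact: le_measureU2.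
Qed.

End subadditivity.

Section coupling_bounds.
Context {R : realType} {d : measure_display} {T : measurableType d}.
Variables (mu : {measure set T -> \bar R}) (h0 h1 : T -> R).
Hypothesis mu1 : mu setT = 1%E.
Hypotheses (mh0 : measurable_fun setT h0) (mh1 : measurable_fun setT h1).
Local Open Scope ereal_scope.

Lemma measurable_sublevel (h : T -> R) (y : R) :
  measurable_fun setT h -> measurable [set v | (h v <= y)%R].
Proof.
move=> mh; have := mh measurableT _ (measurable_itv `]-oo, y]).
rewrite setTI; congr measurable; apply/seteqP; split => v /=;
  by rewrite in_itv.
Qed.

Lemma measurable_sublevel2 (y0 y1 : R) :
  measurable [set v | (h0 v <= y0)%R /\ (h1 v <= y1)%R].
Proof. by apply: measurableI; exact: measurable_sublevel. Qed.

Lemma joint_lower_le (y0 y1 : R) :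
  joint_lower (cdf_of mu h0) (cdf_of mu h1) y0 y1 <= joint_cdf_of mu h0 h1 y0 y1.
Proof.
rewrite /joint_lower /cdf_of /joint_cdf_of ge_max measure_ge0 andbT.
have m0 := measurable_sublevel y0 mh0.
have m1 := measurable_sublevel y1 mh1.
have m01 := measurable_sublevel2 y0 y1.
(* A point with [h0 v <= y0] either lies in the joint event or violates [h1 v <= y1]. *)
have : mu [set v | (h0 v <= y0)%R] <=
    1 + (mu [set v | (h0 v <= y0)%R /\ (h1 v <= y1)%R] -
         mu [set v | (h1 v <= y1)%R]).
  apply: le_measure1UC => // v /= h0v.
  by have [|] := boolP (h1 v <= y1)%R; [left|right; exact/negP].
(* Finiteness of the three masses reduces the claim to linear arithmetic over the reals. *)
move: (fin_num_measure1 mu1 m0) (fin_num_measure1 mu1 m1)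
  (fin_num_measure1 mu1 m01).
case: (mu _) => // a; case: (mu _) => // b; case: (mu _) => // c _ _ _.
by rewrite !lee_fin; lra.
Qed.

Lemma joint_upper_ge (y0 y1 : R) :
  joint_cdf_of mu h0 h1 y0 y1 <= joint_upper (cdf_of mu h0) (cdf_of mu h1) y0 y1.
Proof.
by rewrite /joint_upper /cdf_of /joint_cdf_of le_min; apply/andP; split;
  apply: le_measure; rewrite ?inE; try exact: measurable_sublevel2;
  try exact: measurable_sublevel; move=> v [].
Qed.

Let mh : measurable_fun setT (h1 \- h0)%R := measurable_funB mh1 mh0.

Lemma diff_lower_le (dl : R) :
  diff_lower (cdf_of mu h0) (cdf_of mu h1) dl <= cdf_of mu (h1 \- h0)%R dl.
Proof.
apply: ge_ereal_sup => _ [y _ <-]; rewrite ge_max measure_ge0 andbT /cdf_of.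
have m0 := measurable_sublevel (y - dl) mh0.
(* Moving the finite mass of [h0 v <= y - dl] to the right leaves a union bound. *)
rewrite leeBlDr ?fin_num_measure1//.
apply: le_measureU2; try exact: measurable_sublevel.
move=> v /= hv; have [h0v|h0v] := leP (h0 v) (y - dl)%R; [by right|left; lra].
Qed.

Lemma diff_upper_ge (dl : R) :
  cdf_of mu (h1 \- h0)%R dl <= diff_upper (cdf_of mu h0) (cdf_of mu h1) dl.
Proof.
have md := measurable_sublevel dl mh.
(* With 1 moved to the left, the infimum is tested at each [y]. Each minimum then gives two bounds:
   the Makarov inequality, and total mass at most 1 for the entry 0. *)
rewrite /diff_upper -leeBlDl//; apply: le_ereal_inf_tmp => _ [y _ <-].
rewrite le_min !leeBlDl// adde0; apply/andP; split.
  apply: le_measure1UC => //; try exact: measurable_sublevel.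
  move=> v /= hv; have [h0v|h0v] := leP (h0 v) (y - dl)%R; [by left; lra|right].
  by move=> h0v'; lra.
by rewrite /cdf_of -mu1 le_measure// inE.
Qed.

End coupling_bounds.

(* No measurability: the bounds on the law of Delta involve a supremum over
   uncountably many y.  The integral of a nonnegative function is a supremum
   over the simple functions below it, for any set function [mu]. *)
Lemma ge0_le_integral_setfun (R : realType) d (T : measurableType d)
    (mu : set T -> \bar R) (u v : T -> \bar R) :
  (forall x, 0 <= u x)%E -> (forall x, u x <= v x)%E ->
  (\int[mu]_x u x <= \int[mu]_x v x)%E.
Proof.
move=> u0 uv; have v0 x : (0 <= v x)%E := le_trans (u0 x) (uv x).
have pos (w : T -> \bar R) : (forall x, 0 <= w x)%E ->
    (w ^\+ = w /\ w ^\- = cst 0)%E.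
  by move=> w0; split; apply/funext => x;
    [rewrite (@ge0_funeposE _ _ setT)|rewrite (@ge0_funenegE _ _ setT)]; rewrite ?inE.
rewrite /integral !patch_setT.
have [-> ->] := pos _ u0; have [-> ->] := pos _ v0.
rewrite leeB//; apply: ereal_sup_le => _ [h /= hu <-].
by exists h => //= x; exact: le_trans (hu x) (uv x).
Qed.

Section vars_measurability.
Context {R : realType} {n : nat}.

Lemma measurable_vY0 : measurable_fun setT (@vY0 R n).
Proof.
rewrite (_ : vY0 = fst \o (fst \o (fst \o (fst \o fst)))).
  by do 4!(apply: measurableT_comp => //).
by apply/funext => -[[[[[? ?] ?] ?] ?] ?].
Qed.

Lemma measurable_vDelta : measurable_fun setT (@vDelta R n).
Proof.
rewrite (_ : vDelta = snd \o (fst \o (fst \o (fst \o fst)))).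
  by do 4!(apply: measurableT_comp => //).
by apply/funext => -[[[[[? ?] ?] ?] ?] ?].
Qed.

Lemma measurable_vY1 : measurable_fun setT (@vY1 R n).
Proof. by apply: measurable_funD; [exact: measurable_vY0|exact: measurable_vDelta]. Qed.

(** Transfers the bounds proved for a difference [h1 \- h0] to the treatment effect. *)
Lemma vDeltaE : @vDelta R n = (vY1 \- vY0)%R.
Proof. by apply/funext => v /=; rewrite /vY1 addrAC subrr add0r. Qed.

End vars_measurability.

Theorem corollary4p1 (R : realType) (n k : nat) (d : measure_display)
    (Omega : measurableType d) (P : probability Omega R)
    (Y Y0 Delta Theta : {RV P >-> R}) (D : {RV P >-> bool})
    (Z Gamma : {RV P >-> rvec R n.+2}) (X : {RV P >-> rvec R k})
    (g : rvec R n.+1 -> R) (f : 'I_n.+1 -> R -> R)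
    (kX : R.-pker (rvec R k) ~> vars R n)
    (kC : R.-pker (R * rvec R n.+1 * rvec R k)%type ~> vars R n)
    (kZ kZbar : R.-pker (rvec R n.+1 * rvec R k)%type ~> vars R n) :
  let W : Omega -> vars R n :=
    fun w => (Y0 w, Delta w, D w, Z w, Theta w, Gamma w) in
  (* measurability of the functions in the selection equation *)
  measurable_fun setT g ->
  (forall l, measurable_fun setT (f l)) ->
  (* consistent regular conditional distributions given X, C, (Z_{2-L}, X)
     and (bar Z_{2-L}, X) *)
  is_rcd P W X kX ->
  is_rcd P W (fun w => (vCoef (W w), X w)) kC ->
  is_rcd P W (fun w => (vZtl (W w), X w)) kZ ->
  is_rcd P W (fun w => (vZbar f (W w), X w)) kZbar ->
  consistent P X kX vCoef kC ->
  consistent P X kX vZtl kZ ->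
  consistent P X kX (vZbar f) kZbar ->
  (* the triangular model *)
  (forall w, Y w = Y0 w + Delta w * (D w)%:R) ->
  (forall w, D w = (Theta w - hd (Gamma w) * (hd (Z w) + g (tl (Z w)))
      - \sum_(l < n.+1) tl (Gamma w) 0 l * f l (tl (Z w) 0 l) > 0)) ->
  cond_indep P X kX vZ (fun v => (vTheta v, vGamma v)) ->
  {ae P, forall w, 0 < hd (Gamma w)} ->
  (* assumptions *)
  assumption_A1 P W ->
  assumption_A2 P X kX ->
  assumption_A3 P X kX ->
  (normalizations P W X g f /\ assumption_A4 P W X g f kX kZ) \/
    assumption_A4' P W X f kX kZbar ->
  full_support P X f kX \/ analytic P X f kX ->
  forall x : rvec R k, supp (pushforward P X) x ->
  forall y0 y1 dl : R,
    (FL_Y0Y1 kX kC y0 y1 x <= joint_cdf_of (kX x) vY0 vY1 y0 y1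
       <= FU_Y0Y1 kX kC y0 y1 x)%E /\
    (FL_Delta kX kC dl x <= cdf_of (kX x) vDelta dl
       <= FU_Delta kX kC dl x)%E.
Proof.
move=> W _ _ _ _ _ _ consC _ _ _ _ _ _ _ _ _ _ _ x xX y0 y1 dl.
have kC1 c : kC (c, x) setT = 1%E by exact: prob_kernel.
have m0 := @measurable_vY0 R n; have m1 := @measurable_vY1 R n.
have mD := @measurable_vDelta R n.
rewrite /joint_cdf_of /(cdf_of (kX x)).
(* Consistency holds at this very [x], and it mixes over the same law of [vCoef] that defines the
   bounds; a pointwise comparison in [c] then suffices. *)
rewrite (consC x xX _ (measurable_sublevel2 m0 m1 y0 y1)).
rewrite (consC x xX _ (measurable_sublevel dl mD)).
split; apply/andP; split; apply: ge0_le_integral_setfun => c //.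
- by rewrite le_max lexx orbT.
- exact: joint_lower_le.
- exact: joint_upper_ge.
(* Nonnegativity of the supremum: any [y] would serve as witness, since every term is a maximum with
   0. *)
- apply: le_ereal_sup_tmp; eexists; first by exists 0.
  by rewrite le_max lexx orbT.
- have := diff_lower_le (kC1 c) m0 m1 dl;
  by rewrite -vDeltaE.
- have := diff_upper_ge (kC1 c) m0 m1 dl;
  by rewrite -vDeltaE.
Qed.
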